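(* Let $M_i$ ($i\in\mathbb{N}$) and $M$ be compact length spaces such that $M_i\to M$ in the Gromov–Hausdorff sense, and let $k\in\mathbb{N}$. Then $L_{1/k}(M_i)$ converges to a subset of $L_{1/k}(M)\cup\{0\}$ in the following sense: for all $\epsilon,R>0$ there exists $N\in\mathbb{N}$ such that $$L_{1/k}(M_i)\cap[0,R]\subset T_\epsilon\big(L_{1/k}(M)\cup\{0\}\big)\qquad\text{for all } i\ge N.$$
   Context: A compact length space is a compact metric space in which every pair of points is joined by a rectifiable curve whose length equals the distance between the points. $S^1=\mathbb{R}/2\pi\mathbb{Z}$. A closed geodesic in $M$ is a nonconstant map $\gamma:S^1\to M$ that is locally length minimizing around every point of $S^1$, parametrized proportionally to arclength with speed $L(\gamma)/(2\pi)$, where $L(\gamma)$ is its length. A $1/k$ geodesic is a closed geodesic $\gamma$ with $d(\gamma(t),\gamma(t+2\pi/k))=L(\gamma)/k$ for all $t\in S^1$. $L_{1/k}(M)$ is the set of lengths of $1/k$ geodesics in $M$. For $A\subset\mathbb{R}$, $T_\epsilon(A)=\{z\in\mathbb{R}:\exists x\in A,\ |x-z|<\epsilon\}$. Gromov–Hausdorff convergence means $d_{GH}(M_i,M)\to 0$, where $d_{GH}(X,Y)$ is the infimum of Hausdorff distances $d_H^Z(f(X),g(Y))$ over all metric spaces $Z$ and distance-preserving maps $f:X\to Z$, $g:Y\to Z$. *)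

(* Defs.v *)
From HB Require Import structures.
From mathcomp Require Import all_boot all_order all_algebra.
From mathcomp Require Import all_classical all_reals all_analysis.

Set Implicit Arguments.
Unset Strict Implicit.
Unset Printing Implicit Defensive.

Import Order.TTheory GRing.Theory Num.Theory.
Import numFieldNormedType.Exports.

Local Open Scope classical_set_scope.
Local Open Scope ring_scope.

Section Curves.
Context {R : realType} {X : metricType R}.
Implicit Types (a b : R) (c : R -> X).

(* Metric-valued analogues of [variation] and [total_variation]: the
   partition a = s_0 < s_1 < ... < s_n = b is encoded as in [itv_partition]
   by the list [:: s_1; ...; s_n]. *)
Definition chord_sum a b c (s : seq R) : R :=
  let F := c \o nth b (a :: s) in
  \sum_(0 <= n < size s) mdist (F n) (F n.+1).

Definition curve_length a b c : \bar R :=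
  ereal_sup [set (chord_sum a b c s)%:E | s in itv_partition a b].

Definition curve_from_to a b c (x y : X) : Prop :=
  [/\ a <= b, {within `[a, b], continuous c}, c a = x & c b = y].

Definition length_minimizing a b c : Prop :=
  forall a' b' c', curve_from_to a' b' c' (c a) (c b) ->
    (curve_length a b c <= curve_length a' b' c')%E.

End Curves.

(* Rectifiability of the curve is implied: its length is a real number. *)
Definition length_space (R : realType) (X : metricType R) : Prop :=
  forall x y : X, exists a b (c : R -> X),
    curve_from_to a b c x y /\ curve_length a b c = (mdist x y)%:E.

Definition compact_length_space (R : realType) (X : metricType R) : Prop :=
  compact [set: X] /\ length_space X.

(* A map S^1 = R / 2 pi Z -> X is represented by its lift R -> X, that is, by
   a 2 pi-periodic map. *)
Section ClosedGeodesics.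
Context {R : realType} {X : metricType R}.
Implicit Type g : R -> X.

Definition loop g : Prop :=
  continuous g /\ forall t, g (t + 2 * pi) = g t.

Definition rectifiable_loop g : Prop :=
  loop g /\ curve_length 0 (2 * pi) g \is a fin_num.

(* The value is only meaningful for a rectifiable loop. *)
Definition loop_length g : R := fine (curve_length 0 (2 * pi) g).

Definition locally_minimizing_at g (t : R) : Prop :=
  exists2 e : R, 0 < e &
    forall a b, t - e < a -> a <= b -> b < t + e -> length_minimizing a b g.

Definition closed_geodesic g : Prop :=
  [/\ rectifiable_loop g,
      exists s t, g s <> g t,
      forall t, locally_minimizing_at g t &
      forall a b, a <= b ->
        curve_length a b g = (loop_length g / (2 * pi) * (b - a))%:E].

Definition inv_geodesic (k : nat) g : Prop :=
  closed_geodesic g /\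
  forall t, mdist (g t) (g (t + 2 * pi / k%:R)) = loop_length g / k%:R.

End ClosedGeodesics.

Definition inv_length_spectrum (R : realType) (k : nat) (X : metricType R) :
  set R := [set loop_length g | g in @inv_geodesic R X k].

Definition tubular_nbhd (R : realType) (e : R) (A : set R) : set R :=
  [set z | exists2 x, A x & `|x - z| < e].

(* Extended-real valued, so that the empty set is at distance +oo from any
   nonempty set. *)
Definition hausdorff_dist (R : realType) (Z : metricType R) (A B : set Z) :
  \bar R :=
  ereal_inf [set r%:E | r in [set r : R |
    [/\ 0 < r, A `<=` \bigcup_(b in B) ball b r
             & B `<=` \bigcup_(a in A) ball a r]]].

Definition distance_preserving (R : realType) (X Z : metricType R)
  (f : X -> Z) : Prop := forall x y, mdist (f x) (f y) = mdist x y.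

Definition gromov_hausdorff_dist (R : realType) (X Y : metricType R) :
  \bar R :=
  ereal_inf [set D | exists (Z : metricType R) (f : X -> Z) (g : Y -> Z),
    [/\ distance_preserving f, distance_preserving g
      & D = hausdorff_dist (range f) (range g)]].

(* Main.v *)
Require Import Defs.
From HB Require Import structures.
From mathcomp Require Import all_boot all_order all_algebra.
From mathcomp Require Import all_classical all_reals all_analysis.
From mathcomp Require Import ring lra.

Set Implicit Arguments.
Unset Strict Implicit.
Unset Printing Implicit Defensive.

Import Order.TTheory GRing.Theory Num.Theory.
Import numFieldNormedType.Exports.

Local Open Scope classical_set_scope.
Local Open Scope ring_scope.

(** Being a 1/k geodesic is a closed condition on distances.  A 2 pi-periodic
    map g is a 1/k geodesic of length L = 2 pi v > 0 exactly when

      d (g s) (g t) = v (t - s)   whenever s <= t <= s + 2 pi / k.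

    One direction ([inv_geodesic_minimizing_arcs]) is the equality case of the
    triangle inequality: g is v-Lipschitz because its chords are no longer than
    its arcs, and the chord from g s to g (s + 2 pi / k) has the maximal length
    L / k, so no point in between can lose length.  Conversely
    ([minimizing_arcs_inv_geodesic]) the displayed identity makes g Lipschitz,
    gives every arc the length v (b - a) by summing along fine partitions, and
    makes all arcs shorter than 2 pi / k minimizing; local minimality with a
    uniform scale is what survives in the limit.

    Suppose the theorem fails for eps and r.  Then for each n some M_i, at
    Gromov-Hausdorff distance less than 1/(n+1) from M, carries a 1/k geodesic
    whose length lies in [eps, r] but is not eps-close to the spectrum of M; the
    lower bound eps comes from the point 0 added to the spectrum.  A map
    M_i -> M of distortion at most 2/(n+1) carries this geodesic to a
    (discontinuous) periodic map c_n : R -> M which satisfies the identity up to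
    2/(n+1).  Along an ultrafilter the lengths converge to some L >= eps and, by
    compactness of M, all the c_n t converge at once, t by t.  The identity
    passes to the pointwise limit ([minimizing_arcs_limit]), which is
    therefore a 1/k geodesic of M of length L.  So L is in the spectrum of M and
    is a limit of lengths that stay eps away from it, a contradiction.  As
    pointwise limits suffice, no equicontinuity argument enters: continuity of
    the limit is a consequence of the identity. *)

(** * Length of curves *)

Section CurveLength.
Context {R : realType} {X : metricType R}.
Implicit Types (a b t h v : R) (c g : R -> X).

Lemma mdist_quadrangle (x y x' y' : X) :
  `|mdist x y - mdist x' y'| <= mdist x x' + mdist y y'.
Proof.
have := metric_triangle x x' y; have := metric_triangle x' y' y.
have := metric_triangle x' x y'; have := metric_triangle x y y'.
rewrite (metric_sym x' x) (metric_sym y' y) => *.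
by rewrite ler_norml; apply/andP; split; lra.
Qed.

Lemma chord_sum_cons a b c x s :
  chord_sum a b c (x :: s) = mdist (c a) (c x) + chord_sum x b c s.
Proof. by rewrite /chord_sum /= big_nat_recl. Qed.

Lemma chord_sum_nil a b c : chord_sum a b c [::] = 0.
Proof. by rewrite /chord_sum /= big_geq. Qed.

Lemma chord_sum_le_length a b c s :
  itv_partition a b s -> ((chord_sum a b c s)%:E <= curve_length a b c)%E.
Proof. by move=> abs; apply: ereal_sup_ubound; exists s. Qed.

Lemma mdist_le_length a b c : a <= b ->
  ((mdist (c a) (c b))%:E <= curve_length a b c)%E.
Proof.
rewrite le_eqVlt => /predU1P[<-|ab].
  rewrite mdistxx -(chord_sum_nil a a c).
  by apply: chord_sum_le_length; split => //=.
rewrite (_ : mdist _ _ = chord_sum a b c [:: b]).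
  by apply: chord_sum_le_length; split; rewrite /= ?ab ?eqxx.
by rewrite chord_sum_cons chord_sum_nil addr0.
Qed.

(** No curve is shorter than the distance between its endpoints. *)
Lemma length_minimizing_of_eq_mdist a b c :
  curve_length a b c = (mdist (c a) (c b))%:E -> length_minimizing a b c.
Proof.
rewrite /length_minimizing => -> a' b' c' [ab' _ <- <-].
exact: mdist_le_length.
Qed.

(** * Curves whose short arcs are minimizing *)

(** This prescribes only distances, with neither continuity nor length, so that
    it is preserved by pointwise limits. *)
Definition minimizing_arcs v h g :=
  forall s t, s <= t -> t <= s + h -> mdist (g s) (g t) = v * (t - s).

Section MinimizingArcs.
Variables (v h : R) (g : R -> X).
Hypotheses (h0 : 0 < h) (arcs : minimizing_arcs v h g).

Lemma minimizing_arcs_speed_ge0 : 0 <= v.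
Proof.
have := mdist_ge0 (g 0) (g h).
rewrite arcs ?subr0 ?add0r ?(ltW h0)//.
by rewrite pmulr_lge0.
Qed.

(** Cut [s, t] into pieces no longer than h and apply the triangle
    inequality. *)
Lemma minimizing_arcs_lipschitz s t : s <= t ->
  mdist (g s) (g t) <= v * (t - s).
Proof.
move=> st.
have [n] : exists n, t - s <= n%:R * h.
  exists (Num.bound ((t - s) / h)).
  rewrite -ler_pdivrMr//; apply/ltW/archi_boundP.
  by rewrite divr_ge0 ?(ltW h0)// subr_ge0.
elim: n s st => [|n IH] s st.
  rewrite mul0r subr_le0 => ts.
  have -> : t = s by apply/eqP; rewrite eq_le ts st.
  by rewrite mdistxx subrr mulr0.
rewrite -natr1 mulrDl mul1r => tsn.
have [tsh|tsh] := leP t (s + h); first by rewrite arcs.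
apply: le_trans (metric_triangle _ (g (s + h)) _) _.
have -> : v * (t - s) = v * (s + h - s) + v * (t - (s + h)) by ring.
apply: lerD; first by rewrite arcs ?lexx// lerDl ltW.
by apply: IH; [exact: ltW|lra].
Qed.

Lemma minimizing_arcs_continuous : continuous g.
Proof.
have v0 := minimizing_arcs_speed_ge0.
have lip s t : mdist (g s) (g t) <= v * `|t - s|.
  wlog st : s t / s <= t.
    move=> wl; have [/wl //|/ltW/wl] := leP s t.
    by rewrite metric_sym distrC.
  by rewrite ger0_norm ?subr_ge0//; exact: minimizing_arcs_lipschitz.
move=> s; apply/metricType_numDomainType.cvgrPdist_lt => e e0.
near=> t.
apply: le_lt_trans (lip _ _) _.
(* v may vanish, hence the denominator v + 1. *)
have : `|s - t| < e / (v + 1).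
  near: t; apply: cvgr_dist_lt => //.
  by rewrite divr_gt0// ltr_wpDl.
rewrite distrC ltr_pdivlMr ?ltr_wpDl// mulrC; apply: le_lt_trans.
by rewrite ler_wpM2r// lerDl.
Unshelve. all: by end_near. Qed.

Lemma minimizing_arcs_chord_sum_le a b s : path <%R a s ->
  chord_sum a b g s <= v * (last a s - a).
Proof.
elim: s a => [|x s IH] a /=; first by rewrite chord_sum_nil subrr mulr0.
move=> /andP[ax /IH{}IH]; rewrite chord_sum_cons.
have -> : v * (last x s - a) = v * (x - a) + v * (last x s - x) by ring.
by apply: lerD => //; apply: minimizing_arcs_lipschitz; exact: ltW.
Qed.

(** A partition of mesh at most h has only minimizing pieces, so its chord sum
    attains the upper bound given by the Lipschitz estimate. *)
Lemma minimizing_arcs_partition a b : a <= b ->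
  exists2 s, itv_partition a b s & chord_sum a b g s = v * (b - a).
Proof.
move=> ab.
have [n] : exists n, b - a <= n%:R * h.
  exists (Num.bound ((b - a) / h)).
  rewrite -ler_pdivrMr//; apply/ltW/archi_boundP.
  by rewrite divr_ge0 ?(ltW h0)// subr_ge0.
elim: n a ab => [|n IH] a ab.
  rewrite mul0r subr_le0 => ba.
  have -> : a = b by apply/eqP; rewrite eq_le ab ba.
  by exists [::]; rewrite ?chord_sum_nil ?subrr ?mulr0//; split.
rewrite -natr1 mulrDl mul1r => bn.
have [bah|bah] := ltP (a + h) b.
  have [|s [s1 s2] s3] := IH (a + h) (ltW bah); first by lra.
  exists (a + h :: s).
    by split => //=; rewrite ltrDl h0.
  rewrite chord_sum_cons s3 arcs ?lexx ?lerDl ?ltW//.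
  by ring.
move: ab; rewrite le_eqVlt => /predU1P[<-|ab].
  by exists [::]; rewrite ?chord_sum_nil ?subrr ?mulr0//; split.
exists [:: b]; first by split; rewrite /= ?ab ?eqxx.
by rewrite chord_sum_cons chord_sum_nil addr0 arcs// ltW.
Qed.

Lemma minimizing_arcs_length a b : a <= b ->
  curve_length a b g = (v * (b - a))%:E.
Proof.
move=> ab; apply/eqP; rewrite eq_le; apply/andP; split.
  apply: ge_ereal_sup => _ [s abs <-].
  by rewrite lee_fin; case: abs => abs /eqP <-; exact: minimizing_arcs_chord_sum_le.
have [s abs <-] := minimizing_arcs_partition ab.
exact: chord_sum_le_length.
Qed.

Lemma minimizing_arcs_locally_minimizing t : locally_minimizing_at g t.
Proof.
(* Points at distance less than h / 2 from t are less than h apart. *)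
exists (h / 2); first by rewrite divr_gt0.
move=> a b ta ab bt; apply: length_minimizing_of_eq_mdist.
by rewrite minimizing_arcs_length// arcs//; lra.
Qed.

End MinimizingArcs.

(** * Metric characterization of 1/k geodesics *)

Lemma closed_geodesic_lipschitz g a b : closed_geodesic g -> a <= b ->
  mdist (g a) (g b) <= loop_length g / (2 * pi) * (b - a).
Proof.
by move=> [_ _ _ len] ab; rewrite -lee_fin -len//; exact: mdist_le_length.
Qed.

(** Equality case of the triangle inequality: both halves of the chord from g s
    to g (s + 2 pi / k) are at most as long as the corresponding arcs, while the
    whole chord is as long as the whole arc. *)
Lemma inv_geodesic_minimizing_arcs (k : nat) g : (0 < k)%N ->
  inv_geodesic k g ->
  minimizing_arcs (loop_length g / (2 * pi)) (2 * pi / k%:R) g.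
Proof.
move=> k0 [geo inv] s t st tsh.
have pi0 := pi_gt0 R.
have kR : (0 : R) < k%:R by rewrite ltr0n.
apply/eqP; rewrite eq_le closed_geodesic_lipschitz//=.
have := metric_triangle (g s) (g t) (g (s + 2 * pi / k%:R)).
have := closed_geodesic_lipschitz geo tsh.
rewrite inv => H1 H2.
rewrite -(lerD2r (loop_length g / (2 * pi) * (s + 2 * pi / k%:R - t))).
have -> : loop_length g / (2 * pi) * (t - s) +
   loop_length g / (2 * pi) * (s + 2 * pi / k%:R - t) = loop_length g / k%:R.
  (* [pi] is abstracted so that [field] does not unfold it. *)
  have : pi != 0 :> R by rewrite gt_eqF.
  move: (loop_length g) (pi : R) => l p p0.
  by field; rewrite p0 gt_eqF.
apply: le_trans H2 _.
by rewrite lerD2l.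
Qed.

Lemma minimizing_arcs_inv_geodesic (k : nat) v g : (0 < k)%N -> 0 < v ->
  (forall t, g (t + 2 * pi) = g t) ->
  minimizing_arcs v (2 * pi / k%:R) g ->
  inv_geodesic k g /\ loop_length g = v * (2 * pi).
Proof.
move=> k0 v0 per arcs.
have pi0 := pi_gt0 R.
have kR : (0 : R) < k%:R by rewrite ltr0n.
have h0 : 0 < 2 * pi / k%:R :> R by rewrite !(divr_gt0, mulr_gt0).
have len0 : curve_length 0 (2 * pi) g = (v * (2 * pi))%:E.
  by rewrite (minimizing_arcs_length h0 arcs) ?subr0// mulr_ge0// ltW.
have len : loop_length g = v * (2 * pi) by rewrite /loop_length len0.
have vE : loop_length g / (2 * pi) = v by rewrite len mulfK// gt_eqF ?mulr_gt0.
split=> //; split; last first.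
  move=> t; rewrite arcs ?lexx ?lerDl ?ltW// len; field.
  by rewrite gt_eqF.
split.
- split; last by rewrite len0.
  by split => //; exact: minimizing_arcs_continuous arcs.
- exists 0, (2 * pi / k%:R) => g0.
  have := arcs 0 (2 * pi / k%:R); rewrite -g0 mdistxx add0r subr0.
  move=> /(_ (ltW h0) (lexx _))/esym/eqP.
  by rewrite gt_eqF// mulr_gt0.
- by move=> t; exact: minimizing_arcs_locally_minimizing arcs t.
- by move=> a b ab; rewrite vE; exact: (minimizing_arcs_length h0 arcs).
Qed.

End CurveLength.

(** * Approximations and limits *)

(** Send x to some point of Y at distance less than d from x in a common
    ambient space; such a map need not be continuous. *)
Lemma gromov_hausdorff_approximation (R : realType) (X Y : metricType R)
    (d : R) : (gromov_hausdorff_dist X Y < d%:E)%E ->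
  exists f : X -> Y, forall x x',
    `|mdist (f x) (f x') - mdist x x'| <= 2 * d.
Proof.
move=> /ereal_inf_lt[_ [Z [i [j [iso_i iso_j ->]]]]].
move=> /ereal_inf_lt[_ [r [r0 XY _] <-]]; rewrite lte_fin => rd.
have near_pt x : exists y, mdist (j y) (i x) < r.
  have [|_ [y _ <-]] := XY (i x); first by exists x.
  by rewrite ballEmdist => xy; exists y.
have [f fP] := choice near_pt; exists f => x x'.
rewrite -iso_i -iso_j; apply: le_trans (mdist_quadrangle _ _ _ _) _.
by have := fP x; have := fP x'; lra.
Qed.

(** In place of extracting a subsequence, an ultrafilter makes uncountably many
    sequences converge simultaneously. *)
Lemma ultrafilter_compact_cvg (T : Type) (U : topologicalType) (A : set U)
    (F : set_system T) (u : T -> U) : UltraFilter F -> compact A ->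
  (forall i, A (u i)) -> exists2 x, A x & u @ F --> x.
Proof.
move=> FU cA Au.
have uA : (u @ F) A by apply: (@filterE _ F).
have [x [Ax xcl]] := cA (u @ F) _ uA.
exists x => // B xB.
have [//|FB] := in_ultra_setVsetC (u @^-1` B) FU.
by have [y [nBy By]] := xcl (~` B) B FB xB.
Qed.

(** The speeds may vary with i and the curves c i may be discontinuous: the two
    sides of the defining identity converge for each fixed s and t. *)
Lemma minimizing_arcs_limit (R : realType) (M : metricType R) (T : Type)
    (F : set_system T) (c : T -> R -> M) (g : R -> M) (v err : T -> R) (w h : R) :
  ProperFilter F ->
  (forall t, c ^~ t @ F --> g t) -> v @ F --> w -> err @ F --> 0 ->
  (forall i s t, s <= t -> t <= s + h ->
    `|mdist (c i s) (c i t) - v i * (t - s)| <= err i) ->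
  minimizing_arcs w h g.
Proof.
move=> FF cg vw err0 cP s t st tsh.
apply/eqP; rewrite -subr_eq0 -normr_le0; apply/ler_addgt0Pr => e e0.
rewrite add0r.
have e40 : 0 < e / 4 by rewrite divr_gt0.
have vst : (fun i => v i * (t - s)) @ F --> w * (t - s) by exact: cvgMr_tmp.
near F => i.
have H1 : mdist (g s) (c i s) < e / 4.
  by near: i; apply: metricType_numDomainType.cvgr_dist_lt.
have H2 : mdist (g t) (c i t) < e / 4.
  by near: i; apply: metricType_numDomainType.cvgr_dist_lt.
have H3 : `|w * (t - s) - v i * (t - s)| < e / 4.
  by near: i; apply: cvgr_dist_lt.
have H4 : `|0 - err i| < e / 4 by near: i; apply: cvgr_dist_lt.
have H5 := cP i s t st tsh.
have H6 := mdist_quadrangle (g s) (g t) (c i s) (c i t).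
move: H3 H4 H5 H6; rewrite sub0r normrN ltr_norml.
move=> /andP[? ?] /ltr_normlW ?; rewrite !ler_norml.
by move=> /andP[? ?] /andP[? ?]; apply/andP; split; lra.
Unshelve. all: by end_near. Qed.

Theorem theorem7p1 (R : realType) (M_ : nat -> metricType R)
    (M : metricType R) (k : nat) :
  (forall i, compact_length_space (M_ i)) ->
  compact_length_space M ->
  gromov_hausdorff_dist (M_ i) M @[i --> \oo] --> 0%E ->
  (0 < k)%N ->
  forall eps r : R, 0 < eps -> 0 < r ->
  exists N : nat, forall i : nat, (N <= i)%N ->
    inv_length_spectrum k (M_ i) `&` `[0, r]
      `<=` tubular_nbhd eps (inv_length_spectrum k M `|` [set 0]).
Proof.
move=> _ [Mc _] GH k0 eps r eps0 r0.
have pi0 := pi_gt0 R.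
have pi20 : 0 < 2 * pi :> R by rewrite mulr_gt0.
pose h : R := 2 * pi / k%:R.
apply: contrapT => noN.
(* A pair cv stands for a curve in M together with its approximate speed, so
   that the sequence below lives in M alone and not in the varying M_ i. *)
have bad n : exists cv : (R -> M) * R, [/\ cv.2 * (2 * pi) \in `[eps, r],
    ~ tubular_nbhd eps (inv_length_spectrum k M `|` [set 0]) (cv.2 * (2 * pi)),
    forall t, cv.1 (t + 2 * pi) = cv.1 t &
    forall s t, s <= t -> t <= s + h ->
      `|mdist (cv.1 s) (cv.1 t) - cv.2 * (t - s)| <= 2 * n.+1%:R^-1].
  have [N _ NP] : \forall i \near \oo,
      (gromov_hausdorff_dist (M_ i) M < (n.+1%:R^-1)%:E)%E.
    apply: (GH [set x | (x < (n.+1%:R^-1)%:E)%E]).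
    apply: open_nbhs_nbhs; split; first exact: open_ereal_lt_ereal.
    by rewrite /= lte_fin invr_gt0.
  apply: contrapT => nex; apply: noN; exists N => i Ni L [[g gk <-]].
  rewrite /= in_itv /= => /andP[L0 Lr]; apply: contrapT => ntub; apply: nex.
  have [f fP] := gromov_hausdorff_approximation (NP _ Ni).
  have LE : loop_length g / (2 * pi) * (2 * pi) = loop_length g.
    by rewrite divfK// gt_eqF.
  exists (f \o g, loop_length g / (2 * pi)); split => /=.
  - rewrite LE in_itv /= Lr andbT leNgt; apply/negP => Leps; apply: ntub.
    by exists 0; [right|rewrite sub0r normrN ger0_norm].
  - by rewrite LE.
  - by case: gk => -[[[_ per] _] _ _ _] _ t; rewrite per.
  - move=> s t st tsh; rewrite -(inv_geodesic_minimizing_arcs k0 gk st tsh).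
    exact: fP.
have [cv cvP] := choice bad.
have [F [FU ooF]] := @ultraFilterLemma nat \oo _.
have [|L] := ultrafilter_compact_cvg (u := fun n => (cv n).2 * (2 * pi)) FU
  (@segment_compact R eps r); first by move=> n; case: (cvP n).
rewrite /= in_itv /= => /andP[epsL _] vL.
have lim t : exists x : M, (fun n => (cv n).1 t) @ F --> x.
  have [//|x _ ?] := ultrafilter_compact_cvg (u := fun n => (cv n).1 t) FU Mc.
  by exists x.
have [g gP] := choice lim.
have vw : (fun n => (cv n).2) @ F --> L / (2 * pi).
  rewrite (_ : (fun n => _) = fun n => (cv n).2 * (2 * pi) / (2 * pi)).
    exact: cvgMr_tmp.
  by apply/funext => n; rewrite mulfK// gt_eqF.
have err0 : (fun n => 2 * n.+1%:R^-1) @ F --> (0 : R).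
  apply: (@cvg_trans _ ((fun n => 2 * n.+1%:R^-1 : R) @ \oo)).
    by move=> A; exact: ooF.
  have H := cvgM (cvg_cst (2 : R)) (@cvg_harmonic R).
  rewrite mulr0 in H. exact: H.
have arcs : minimizing_arcs (L / (2 * pi)) h g.
  have almost n : forall s t, s <= t -> t <= s + h ->
      `|mdist ((cv n).1 s) ((cv n).1 t) - (cv n).2 * (t - s)| <= 2 / n.+1%:R.
    by case: (cvP n).
  exact: (minimizing_arcs_limit (c := fun n => (cv n).1) _
    gP vw err0 almost).
have per t : g (t + 2 * pi) = g t.
  have shift : (fun n => (cv n).1 (t + 2 * pi)) = (fun n => (cv n).1 t).
    by apply/funext => n; case: (cvP n).
  have := gP (t + 2 * pi); rewrite shift => shifted.
  exact: (cvg_unique (@metric_hausdorff _ M) shifted (gP t)).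
have L0 : 0 < L := lt_le_trans eps0 epsL.
have [gk gL] := minimizing_arcs_inv_geodesic k0 (divr_gt0 L0 pi20) per arcs.
rewrite divfK ?gt_eqF// in gL.
near F => n.
have [_ + _ _] := cvP n; apply.
exists L; first by left; exists g.
by near: n; apply: cvgr_dist_lt.
Unshelve. all: by end_near. Qed.
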